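(* Let $n>k\ge 1$, let $X$ be a non-random real $n\times k$ matrix of rank $k$, $\beta\in\mathbb{R}^k$, and $Y=X\beta+\varepsilon$, where the random vector $\varepsilon\in\mathbb{R}^n$ satisfies $E(\varepsilon)=0$ and $\operatorname{cov}(\varepsilon)=\sigma^2 I_n$ with $\sigma^2>0$. Let $q\in\mathbb{R}^k$ be an arbitrary vector with $q^Tq=1$. Let $b$, $\delta$, $e$ be the OLS-estimator, its random error and the residual vector, let $$\tilde c=\frac{E\left(\sqrt{(q^T\delta)^2\,e^Te}\right)}{E(e^Te)},\qquad \tilde b=b-\operatorname{sign}(q^T\delta)\,\tilde c\,\sqrt{e^Te}\;q .$$ Then $$E\big((\tilde b-\beta)^T(\tilde b-\beta)\big)<E\big((b-\beta)^T(b-\beta)\big),$$ i.e. $\tilde L^2<L^2$.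
   Context: The OLS-estimator is $b=(X^TX)^{-1}X^TY$; its random error is $\delta=b-\beta=(X^TX)^{-1}X^T\varepsilon$; the residual vector is $e=Y-Xb$. The sign function is $\operatorname{sign}(x)=1$ if $x\ge 0$ and $\operatorname{sign}(x)=-1$ if $x<0$. All square roots are nonnegative. $L^2=E((b-\beta)^T(b-\beta))$ and $\tilde L^2=E((\tilde b-\beta)^T(\tilde b-\beta))$ are the mean squared distances (quadratic risks) of $b$ and of the quasi-estimator $\tilde b$. $I_n$ is the $n\times n$ identity matrix and $\operatorname{cov}(\varepsilon)$ is the variance-covariance matrix.
   Formalization: The formal theorem additionally assumes that q^Tδ ≠ 0 and e ≠ 0 hold together with positive probability; without this c̃ = 0 and the risks are equal, e.g. X=(1,0)^T, q=1, β=0, ε uniform on {±(1,0), ±(0,1)}. *)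

(* Defs.v *)
From mathcomp Require Import all_boot all_order all_algebra.
From mathcomp Require Import all_classical all_reals all_analysis.

Set Implicit Arguments.
Unset Strict Implicit.
Unset Printing Implicit Defensive.

Import Order.TTheory GRing.Theory Num.Theory.

Local Open Scope ring_scope.

(* u^T v; the product is a 1 x 1 matrix, read off as a scalar. *)
Definition dot (R : realType) (m : nat) (u v : 'cV[R]_m) : R :=
  (u^T *m v) ord0 ord0.

(* Unlike Num.sg, this takes the value 1 at 0. *)
Definition sgn1 (R : realType) (x : R) : R := if 0 <= x then 1 else -1.

Definition random_vector (d : measure_display) (T : measurableType d)
    (R : realType) (P : probability T R) (n : nat)
    (eps : 'I_n -> {RV P >-> R}) : T -> 'cV[R]_n :=
  fun w => \col_i eps i w.

Section ols.
Variables (R : realType) (n k : nat) (X : 'M[R]_(n, k)).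

Definition ols (y : 'cV[R]_n) : 'cV[R]_k := invmx (X^T *m X) *m X^T *m y.

Definition ols_error (beta : 'cV[R]_k) (y : 'cV[R]_n) : 'cV[R]_k :=
  ols y - beta.

Definition residual (y : 'cV[R]_n) : 'cV[R]_n := y - X *m ols y.

Variables (d : measure_display) (T : measurableType d) (P : probability T R).
Variables (beta q : 'cV[R]_k) (Y : T -> 'cV[R]_n).

(* Both expectations are integrals with values in \bar R; they are finite as
   soon as the errors have finite second moments, so that [fine] is harmless.
   The coefficient vanishes when almost surely q^T delta = 0 or e = 0, and the
   quasi-estimator is then the OLS estimator itself. *)
Definition quasi_coef : R :=
  fine 'E_P[fun w => Num.sqrt (dot q (ols_error beta (Y w)) ^+ 2 *
                               dot (residual (Y w)) (residual (Y w)))] /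
  fine 'E_P[fun w => dot (residual (Y w)) (residual (Y w))].

Definition quasi_estimator (w : T) : 'cV[R]_k :=
  ols (Y w) - (sgn1 (dot q (ols_error beta (Y w))) * quasi_coef *
               Num.sqrt (dot (residual (Y w)) (residual (Y w)))) *: q.

(* Mean squared distance of a random vector to beta. *)
Definition quadratic_risk (b : T -> 'cV[R]_k) : \bar R :=
  'E_P[fun w => dot (b w - beta) (b w - beta)].

End ols.

(* Main.v *)
Require Import Defs.
From mathcomp Require Import all_boot all_order all_algebra.
From mathcomp Require Import all_classical all_reals all_analysis.
From mathcomp Require Import measurable_realfun ring.

(** Write D for q^T delta and r for sqrt(e^T e), so that e^T e = r^2.  Because
    q is a unit vector and sign(D) D = |D|, subtracting sign(D) c r q from the
    error delta changes its squared length pointwise by exactly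

      - 2 c |D| r + c^2 r^2                              ([dot_quasi_step]).

    Taking expectations, the risk changes by - 2 c M + c^2 V, where
    M = E(|D| r) = E(sqrt(D^2 e^T e)) and V = E(e^T e).  The coefficient M / V
    is the minimizer of this quadratic polynomial in c, and there the change
    is - M^2 / V ([expectation_quadratic_lt]).  It is strictly negative because
    M > 0 and V > 0: both integrands are nonnegative, and they do not vanish
    where D and e are both nonzero, which has positive probability
    ([expectation_gt0]).

    The analytic content is that all these expectations are finite.  A finite
    covariance of eps_i with itself puts eps_i in L^2 ([Lfun2_variance]); delta
    and e are affine in eps, hence have coordinates in L^2 ([sqr_int_affine]);
    and products of two L^2 functions are in L^1 ([Lfun1_dot] for
    delta^T delta and e^T e, [Lfun1_sqrt_sqrM] for |D| r). *)

Set Implicit Arguments.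
Unset Strict Implicit.
Unset Printing Implicit Defensive.

Import Order.TTheory GRing.Theory Num.Theory.

Local Open Scope classical_set_scope.
Local Open Scope ring_scope.

(** * Square-integrable functions *)

Lemma Lfun2_of_integrable_sqr d (T : measurableType d) (R : realType)
    (mu : {measure set T -> \bar R}) (f : T -> R) :
  measurable_fun [set: T] f ->
  (\int[mu]_w (f w ^+ 2)%:E < +oo)%E -> f \in Lfun mu 2%:E.
Proof.
move=> mf foo; rewrite inE; apply/andP; split; first by rewrite inE.
rewrite inE/= /finite_norm unlock poweR_lty//.
rewrite (eq_integral (fun w => (f w ^+ 2)%:E))// => w _ /=.
by rewrite powR_mulrn// -normrX ger0_norm// sqr_ge0.
Qed.

(** A finite variance only says that the centred function is in L^2; the mean
    is added back as a constant, which needs the measure to be finite. *)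
Lemma Lfun2_variance d (T : measurableType d) (R : realType)
    (P : probability T R) (f : T -> R) :
  measurable_fun [set: T] f -> (covariance P f f < +oo)%E -> f \in Lfun P 2%:E.
Proof.
move=> mf; rewrite unlock; set m := fine _; rewrite unlock => foo.
have -> : f = (f \- cst m) + cst m by apply/funext => w; rewrite !fctE subrK.
have fm2 : (f \- cst m) \in Lfun P 2%:E.
  apply: Lfun2_of_integrable_sqr; first exact: measurable_funB.
  by under eq_integral => w _ do rewrite expr2.
by rewrite rpredD ?lee1n// => p1; rewrite ?fm2 ?Lfun_cst.
Qed.

Lemma measurable_neq0 d (T : measurableType d) (R : realType) (f : T -> R) :
  measurable_fun [set: T] f -> measurable [set w | f w != 0].
Proof.
move=> mf; rewrite (_ : [set w | _] = [set: T] `&` [set w | (f w)%:E != 0%E]).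
  by apply: emeasurable_neq => //; exact/measurable_EFinP.
by rewrite setTI.
Qed.

(** A nonnegative function with zero integral vanishes almost everywhere, so
    the set where it is nonzero is negligible. *)
Lemma expectation_gt0 d (T : measurableType d) (R : realType)
    (P : probability T R) (f : T -> R) :
  measurable_fun [set: T] f -> (forall w, 0 <= f w) ->
  (0 < P [set w | (f w != 0)%R])%E -> (0 < 'E_P[f])%E.
Proof.
move=> mf f0 Pf; rewrite lt_neqAle expectation_ge0// andbT.
apply: contraTN Pf => /eqP Ef0; rewrite -leNgt measure_le0.
have mEf : measurable_fun [set: T] (EFin \o f) by exact/measurable_EFinP.
apply/eqP/negligibleP; first exact: measurable_neq0.
suff [N [mN N0 sN]] : ae_eq P setT (EFin \o f) (cst 0%E).
  exists N; split => // w /= fw; apply: sN => /= /(_ I) [fw0].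
  by rewrite fw0 eqxx in fw.
apply/(ae_eq_integral_abs P measurableT mEf); rewrite [RHS]Ef0 unlock.
by apply: eq_integral => w _; rewrite gee0_abs ?lee_fin.
Qed.

Lemma measurable_sqrt d (T : measurableType d) (R : realType) (f : T -> R) :
  measurable_fun [set: T] f -> measurable_fun [set: T] (fun w => Num.sqrt (f w)).
Proof.
move=> mf; apply: (measurableT_comp _ mf).
by apply: continuous_measurable_fun; exact: sqrt_continuous.
Qed.

Lemma measurable_Lfun d (T : measurableType d) (R : realType)
    (mu : {measure set T -> \bar R}) (p : \bar R) (f : T -> R) :
  f \in Lfun mu p -> measurable_fun [set: T] f.
Proof. by move/sub_Lfun_mfun; rewrite inE. Qed.

(** Since sqrt(g) is in L^2, so is the product f sqrt(g) in L^1, and the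
    function at hand is its absolute value. *)
Lemma Lfun1_sqrt_sqrM d (T : measurableType d) (R : realType)
    (mu : {measure set T -> \bar R}) (f g : T -> R) :
  (forall w, 0 <= g w) -> f \in Lfun mu 2%:E -> g \in Lfun mu 1 ->
  (fun w => Num.sqrt (f w ^+ 2 * g w)) \in Lfun mu 1.
Proof.
move=> g0 f2 g1; set h := (X in X \in _).
have -> : h = Num.norm \o (f \* (fun w => Num.sqrt (g w))).
  apply/funext => w; rewrite /h /= sqrtrM ?sqr_ge0// sqrtr_sqr normrM.
  by rewrite [X in _ = _ * X]ger0_norm// sqrtr_ge0.
apply/Lfun_norm/Lfun2_mul_Lfun1 => //; apply: Lfun2_of_integrable_sqr.
  exact/measurable_sqrt/(measurable_Lfun g1).
under eq_integral => w _ do rewrite sqr_sqrtr//.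
have /Lfun1_integrable/integrable_lty := g1; exact.
Qed.

(** * Square-integrable random vectors *)

Definition sqr_int d (T : measurableType d) (R : realType)
    (mu : {measure set T -> \bar R}) (m : nat) (V : T -> 'cV[R]_m) :=
  forall i, (fun w => V w i ord0) \in Lfun mu 2%:E.

Lemma sqr_int_affine d (T : measurableType d) (R : realType)
    (P : probability T R) (m n : nat) (V : T -> 'cV[R]_n)
    (A : 'M[R]_(m, n)) (c : 'cV[R]_m) :
  sqr_int P V -> sqr_int P (fun w => A *m V w + c).
Proof.
move=> V2 i; set f := (X in X \in _).
have -> : f = \sum_j A i j *: (fun w => V w j ord0) + cst (c i ord0).
  by apply/funext => w; rewrite /f !fctE fct_sumE !mxE.
rewrite rpredD ?lee1n// => p1; last exact: Lfun_cst.
by rewrite rpred_sum// => j _; rewrite rpredZ//; exact: V2.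
Qed.

Lemma Lfun1_dot d (T : measurableType d) (R : realType)
    (mu : {measure set T -> \bar R}) (m : nat) (U V : T -> 'cV[R]_m) :
  sqr_int mu U -> sqr_int mu V -> (fun w => dot (U w) (V w)) \in Lfun mu 1.
Proof.
move=> U2 V2; set f := (X in X \in _).
have -> : f = \sum_i ((fun w => U w i ord0) \* (fun w => V w i ord0)).
  apply/funext => w; rewrite /f /dot fct_sumE mxE.
  by apply: eq_bigr => i _; rewrite mxE.
by rewrite rpred_sum// => i _; rewrite Lfun2_mul_Lfun1.
Qed.

Lemma Lfun2_dotl d (T : measurableType d) (R : realType)
    (P : probability T R) (m : nat) (q : 'cV[R]_m) (V : T -> 'cV[R]_m) :
  sqr_int P V -> (fun w => dot q (V w)) \in Lfun P 2%:E.
Proof.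
move=> V2; have := sqr_int_affine q^T 0 V2 ord0.
by under eq_fun do rewrite addr0.
Qed.

(** * Euclidean geometry *)

Lemma dotE (R : realType) (m : nat) (u v : 'cV[R]_m) :
  dot u v = \sum_i u i ord0 * v i ord0.
Proof. by rewrite /dot mxE; apply: eq_bigr => i _; rewrite mxE. Qed.

Lemma dot_ge0 (R : realType) (m : nat) (u : 'cV[R]_m) : 0 <= dot u u.
Proof. by rewrite dotE sumr_ge0// => i _; rewrite -expr2 sqr_ge0. Qed.

Lemma dot_eq0 (R : realType) (m : nat) (u : 'cV[R]_m) :
  (dot u u == 0) = (u == 0).
Proof.
rewrite dotE psumr_eq0; last by move=> i _; rewrite -expr2 sqr_ge0.
apply/allP/eqP => [u0|-> i _]; last by rewrite /= mxE mul0r.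
apply/colP => i; apply/eqP; rewrite mxE.
by have := u0 i (mem_index_enum _); rewrite /= mulf_eq0 orbb.
Qed.

Lemma dot_subZ (R : realType) (m : nat) (u q : 'cV[R]_m) (a : R) :
  dot (u - a *: q) (u - a *: q) = dot u u - 2 * a * dot q u + a ^+ 2 * dot q q.
Proof.
rewrite !dotE !mulr_sumr -sumrB -big_split /=.
by apply: eq_bigr => i _; rewrite !mxE; ring.
Qed.

Lemma sgn1M (R : realType) (x : R) : sgn1 x * x = `|x|.
Proof. by rewrite /sgn1; case: ger0P => _; rewrite ?mul1r ?mulN1r. Qed.

Lemma sqr_sgn1 (R : realType) (x : R) : sgn1 x ^+ 2 = 1.
Proof. by rewrite /sgn1; case: ifP => _; rewrite ?sqrrN expr1n. Qed.

(** The sign is chosen so that the cross term of the expansion is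
    - 2 c |q^T u| sqrt(v); its square is 1 everywhere, also where q^T u = 0,
    because [sgn1] is 1 at 0. *)
Lemma dot_quasi_step (R : realType) (m : nat) (u q : 'cV[R]_m) (c v : R) :
  dot q q = 1 -> 0 <= v ->
  let s := sgn1 (dot q u) * c * Num.sqrt v in
  dot (u - s *: q) (u - s *: q) =
  dot u u - 2 * c * Num.sqrt (dot q u ^+ 2 * v) + c ^+ 2 * v.
Proof.
move=> q1 v0 s; rewrite dot_subZ q1 mulr1 /s sqrtrM ?sqr_ge0// sqrtr_sqr -sgn1M.
rewrite !exprMn sqr_sgn1 sqr_sqrtr//; ring.
Qed.

(** * Minimizing the risk *)

(** The minimum over c of L - 2 c M + c^2 V, attained at c = M / V, is
    L - M^2 / V. *)
Lemma expectation_quadratic_lt d (T : measurableType d) (R : realType)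
    (P : probability T R) (L M V : T -> R) (c : R) :
  L \in Lfun P 1 -> M \in Lfun P 1 -> V \in Lfun P 1 ->
  (0 < 'E_P[M])%E -> (0 < 'E_P[V])%E ->
  c = fine 'E_P[M] / fine 'E_P[V] ->
  ('E_P[fun w => (L w - 2 * c * M w + c ^+ 2 * V w)%R] < 'E_P[L])%E.
Proof.
move=> L1 M1 V1 M0 V0 cE.
have fin_exp f : f \in Lfun P 1 -> exists r, ('E_P[f] = r%:E)%E.
  by move=> /expectation_fin_num f1; exists (fine 'E_P[f])%E; rewrite fineK.
have [l El] := fin_exp _ L1; have [m Em] := fin_exp _ M1.
have [v Ev] := fin_exp _ V1.
have -> : (fun w => L w - 2 * c * M w + c ^+ 2 * V w) =
    (L \- ((2 * c) \o* M)) \+ ((c ^+ 2) \o* V).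
  by apply/funext => w /=; ring.
have M1' := @Lfun_scale _ _ _ P M (2 * c) 1 (lexx _) M1.
have V1' := @Lfun_scale _ _ _ P V (c ^+ 2) 1 (lexx _) V1.
rewrite expectationD ?rpredB// expectationB// !expectationZl//.
move: M0 V0 cE; rewrite El Em Ev /= !lte_fin => m0 v0 cE.
have -> : l - 2 * c * m + c ^+ 2 * v = l - m ^+ 2 / v.
  by rewrite cE; field; rewrite gt_eqF.
by rewrite ltrBlDr ltrDl divr_gt0// exprn_gt0.
Qed.

(** * The quasi-estimator *)

Theorem proposition1 (d : measure_display) (T : measurableType d)
    (R : realType) (P : probability T R)
    (n k : nat) (hk : (1 <= k)%N) (hkn : (k < n)%N)
    (X : 'M[R]_(n, k)) (hX : \rank X = k) (beta : 'cV[R]_k)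
    (eps : 'I_n -> {RV P >-> R}) (Y : T -> 'cV[R]_n)
    (hY : forall w, Y w = X *m beta + random_vector eps w)
    (sigma : R) (hsigma : 0 < sigma ^+ 2)
    (hmean : forall i, ('E_P[eps i] = 0)%E)
    (hcov : forall i j,
        covariance P (eps i) (eps j) = ((sigma ^+ 2 *: 1%:M : 'M[R]_n) i j)%:E)
    (q : 'cV[R]_k) (hq : dot q q = 1)
    (hnd : (0 < P [set w | (dot q (ols_error X beta (Y w)) != 0)%R /\
                           (residual X (Y w) != 0)%R])%E) :
  (quadratic_risk P beta (quasi_estimator X P beta q Y) <
   quadratic_risk P beta (fun w => ols X (Y w)))%E.
Proof.
pose delta w := ols_error X beta (Y w).
pose e w := residual X (Y w).
have Y2 : sqr_int P Y.
  have eps2 : sqr_int P (random_vector eps).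
    move=> i; under eq_fun do rewrite mxE.
    by apply: Lfun2_variance => //; rewrite hcov ltry.
  move=> i; have := sqr_int_affine 1%:M (X *m beta) eps2 i.
  by under eq_fun do rewrite mul1mx addrC -hY.
have delta2 : sqr_int P delta by exact: sqr_int_affine Y2.
have e2 : sqr_int P e.
  move=> i; have := sqr_int_affine
    (1%:M - X *m (invmx (X^T *m X) *m X^T)) 0 Y2 i.
  by under eq_fun do rewrite addr0 mulmxBl mul1mx -mulmxA.
have L1 := Lfun1_dot delta2 delta2.
have V1 := Lfun1_dot e2 e2.
have e0 w : 0 <= dot (e w) (e w) by exact: dot_ge0.
have M1 := Lfun1_sqrt_sqrM e0 (Lfun2_dotl q delta2) V1.
set M := (X in X \in _) in M1.
have M_neq0 w : (M w != 0) = (dot q (delta w) != 0) && (e w != 0).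
  rewrite /M sqrtrM ?sqr_ge0// sqrtr_sqr mulf_eq0 normr_eq0 negb_or.
  by rewrite sqrtr_eq0 le_eqVlt ltNge e0 orbF dot_eq0.
have mM := measurable_Lfun M1; have mV := measurable_Lfun V1.
have PM : (0 < P [set w | (M w != 0)%R])%E.
  rewrite (_ : [set w | _] = [set w | dot q (delta w) != 0 /\ e w != 0])//.
  by apply/seteqP; split => w /=; rewrite M_neq0 => /andP.
have EM : (0 < 'E_P[M])%E by apply: expectation_gt0 => // w; exact: sqrtr_ge0.
(* e cannot vanish where M does not, so e^T e has a positive mean as well. *)
have EV : (0 < 'E_P[fun w => dot (e w) (e w)])%E.
  apply: expectation_gt0 => //; apply: (lt_le_trans PM).
  apply: le_measure; rewrite ?inE; [exact: measurable_neq0..|].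
  by move=> w /=; rewrite M_neq0 dot_eq0 => /andP[].
pose c := quasi_coef X P beta q Y.
have risk_diff w :
    dot (quasi_estimator X P beta q Y w - beta)
        (quasi_estimator X P beta q Y w - beta) =
    dot (delta w) (delta w) - 2 * c * M w + c ^+ 2 * dot (e w) (e w).
  by rewrite /quasi_estimator addrAC; exact: (dot_quasi_step (delta w) c hq (e0 w)).
rewrite /quadratic_risk (funext risk_diff).
exact: expectation_quadratic_lt.
Qed.
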